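(* Let $\gamma\in\mathbb{R}$ and, for $\mu>0$, let $\mathcal{A}_\mu(\overline{0})$ be the operator $\mathcal{A}_\mu(k)$ (depending on $\gamma$) at $k=\overline{0}:=(0,0,0)$. For $\gamma>0$ put $$\mu_l^0(\gamma):=\sqrt{\gamma}\left(\int_{\mathbb{T}^3}\frac{dt}{w_1(\overline{0},t)}\right)^{-1/2}.$$ (i) If $\gamma\le 0$, then for any $\mu>0$ the operator $\mathcal{A}_\mu(\overline{0})$ has a unique negative eigenvalue. (ii) Let $\gamma>0$. Then: (ii$_1$) for any $\mu\in(0,\mu_l^0(\gamma))$ the operator $\mathcal{A}_\mu(\overline{0})$ has no negative eigenvalues; (ii$_2$) if $\mu=\mu_l^0(\gamma)$, then the operator $\mathcal{A}_\mu(\overline{0})$ has a virtual level at the point $z=0$; (ii$_3$) for any $\mu>\mu_l^0(\gamma)$ the operator $\mathcal{A}_\mu(\overline{0})$ has a unique negative eigenvalue.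
   Context: Let $\mathbb{T}^3:=(-\pi,\pi]^3$ be the three-dimensional torus with Lebesgue measure, $\mathcal{H}_0:=\mathbb{C}$, $\mathcal{H}_1:=L_2(\mathbb{T}^3)$ (complex-valued functions), $\mathcal{H}:=\mathcal{H}_0\oplus\mathcal{H}_1$. Put $$\varepsilon(k):=\sum_{i=1}^3(1-\cos k_i),\qquad w_0(k):=\varepsilon(k)+\gamma,\qquad w_1(k,p):=\varepsilon(k)+\varepsilon\left(\tfrac12(k+p)\right)+\varepsilon(p),$$ for $k,p\in\mathbb{T}^3$, where $\gamma\in\mathbb{R}$. For $\mu>0$ and $k\in\mathbb{T}^3$ the bounded self-adjoint operator $\mathcal{A}_\mu(k)$ on $\mathcal{H}$ is $$\mathcal{A}_\mu(k)(f_0,f_1)=\left(w_0(k)f_0+\mu\int_{\mathbb{T}^3}f_1(t)\,dt,\ \ \mu f_0+w_1(k,\cdot)f_1(\cdot)\right).$$ The integral $\int_{\mathbb{T}^3}\frac{dt}{w_1(\overline{0},t)}$ is finite and positive. Virtual level at $z=0$: for $\gamma\neq0$, the operator $\mathcal{A}_\mu(\overline{0})$ is said to have a virtual level at $z=0$ if the number $1$ is an eigenvalue of the integral operator on $C(\mathbb{T}^3)$ (continuous functions on $\mathbb{T}^3$) $$(G_\mu\psi)(q)=\frac{\mu^2}{\gamma}\int_{\mathbb{T}^3}\frac{\psi(t)\,dt}{\varepsilon(t/2)+\varepsilon(t)},\qquad \psi\in C(\mathbb{T}^3),$$ and the associated eigenfunction $\psi$ (determined up to a constant factor) satisfies $\psi(\overline{0})\neq0$.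 *)

(* Defs.v *)
From mathcomp Require Import all_boot all_order all_algebra.
From mathcomp Require Import all_classical all_reals all_analysis.
From mathcomp Require Import complex.
Set Implicit Arguments.
Unset Strict Implicit.
Unset Printing Implicit Defensive.
Import Order.TTheory GRing.Theory Num.Theory numFieldNormedType.Exports.
Local Open Scope classical_set_scope.
Local Open Scope ring_scope.
Local Open Scope complex_scope.

(* A point (k1, k2, k3) is encoded as the nested pair ((k1, k2), k3). *)

Section Torus.
Variable R : realType.

Definition T3 : set (R * R * R) :=
  (`]- pi, pi] `*` `]- pi, pi]) `*` `]- pi, pi].

Definition leb2 : set (measurableTypeR R * measurableTypeR R)%type -> \bar R :=
  (@lebesgue_measure R \x @lebesgue_measure R)%E.

Definition leb3 :
    set (measurableTypeR R * measurableTypeR R * measurableTypeR R)%type ->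
    \bar R :=
  (leb2 \x @lebesgue_measure R)%E.

(* Functions on the torus are encoded as functions on R^3.  Integrals and
   almost-everywhere statements only see their values on T3. *)
Definition cintegral (f : R * R * R -> R[i]) : R[i] :=
  (\int[leb3]_(t in T3) complex.Re (f t)) +i*
  (\int[leb3]_(t in T3) complex.Im (f t)).

(* Representatives of L_2(T^3); they are identified by ae_eq_T3.  Requiring
   Borel measurability is harmless: every Lebesgue class has a Borel
   representative. *)
Definition L2_T3 (f : R * R * R -> R[i]) : Prop :=
  [/\ measurable_fun T3 (fun t => complex.Re (f t)),
      measurable_fun T3 (fun t => complex.Im (f t))
    & (\int[leb3]_(t in T3)
         (complex.Re (f t) ^+ 2 + complex.Im (f t) ^+ 2)%:E < +oo)%E].

Definition ae_eq_T3 (f g : R * R * R -> R[i]) : Prop :=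
  {ae leb3, forall t, T3 t -> f t = g t}.

(* C(T^3): the opposite faces of the cube are identified, so a continuous
   function on the torus is a continuous function on R^3 that is
   2 pi-periodic in each variable. *)
Definition C_T3 (psi : R * R * R -> R[i]) : Prop :=
  continuous (psi : R * R * R -> R[i]^o) /\
  forall a b c, [/\ psi (a + 2 * pi, b, c) = psi (a, b, c),
                    psi (a, b + 2 * pi, c) = psi (a, b, c)
                  & psi (a, b, c + 2 * pi) = psi (a, b, c)].

End Torus.

Section Model.
Variable R : realType.
Implicit Types (k p q t : R * R * R) (gamma mu : R).

Definition eps k : R :=
  (1 - cos k.1.1) + (1 - cos k.1.2) + (1 - cos k.2).

Definition half k : R * R * R := (k.1.1 / 2, k.1.2 / 2, k.2 / 2).

Definition w0 gamma k : R := eps k + gamma.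

Definition w1 k p : R := eps k + eps (half (k + p)) + eps p.

(* Representatives of elements of H = C (+) L_2(T^3), subject to inH and
   identified by eqH. *)
Definition Hrep : Type := (R[i] * (R * R * R -> R[i]))%type.

Definition inH (f : Hrep) : Prop := L2_T3 f.2.

Definition eqH (f g : Hrep) : Prop := f.1 = g.1 /\ ae_eq_T3 f.2 g.2.

Definition zeroH : Hrep := (0, fun=> 0).

Definition scaleH (z : R[i]) (f : Hrep) : Hrep := (z * f.1, fun q => z * f.2 q).

Definition A gamma mu k (f : Hrep) : Hrep :=
  ((w0 gamma k)%:C * f.1 + mu%:C * cintegral f.2,
   fun q => mu%:C * f.1 + (w1 k q)%:C * f.2 q).

Definition eigenvalueH (op : Hrep -> Hrep) (z : R[i]) : Prop :=
  exists f, [/\ inH f, ~ eqH f zeroH & eqH (op f) (scaleH z f)].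

(* In the order of R[i], z < 0 means that z is real and negative. *)
Definition negative_eigenvalue (op : Hrep -> Hrep) (z : R[i]) : Prop :=
  z < 0 /\ eigenvalueH op z.

Definition G gamma mu (psi : R * R * R -> R[i]) : R * R * R -> R[i] :=
  fun=> (mu ^+ 2 / gamma)%:C *
    cintegral (fun t => psi t / (eps (half t) + eps t)%:C).

Definition eigenfunction1_G gamma mu (psi : R * R * R -> R[i]) : Prop :=
  [/\ C_T3 psi, psi <> (fun=> 0) & G gamma mu psi = psi].

(* Meaningful for gamma != 0 only.  The first conjunct says that 1 is an
   eigenvalue; the second one forces the eigenspace to be a line (any
   two-dimensional space of functions contains a nonzero one vanishing at 0),
   so that the eigenfunction is determined up to a constant factor. *)
Definition virtual_level0 gamma mu : Prop :=
  (exists psi, eigenfunction1_G gamma mu psi) /\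
  (forall psi, eigenfunction1_G gamma mu psi -> psi 0 != 0).

Definition mu_l0 gamma : R :=
  Num.sqrt gamma * (Num.sqrt (\int[@leb3 R]_(t in @T3 R) (w1 0 t)^-1))^-1.

End Model.

(* Main.v *)
(* For z = -s < 0, eliminating f_1 from the eigenvalue equations turns them into
   the secular equation gamma + s = mu^2 I(s), where
   I(s) = int_{T^3} dt / (w_1(0,t) + s).  Since w_1(0,t) >= |t|^2 / 32 and
   |x y z|^(2/3) <= x^2 + y^2 + z^2, the function 1 / w_1(0,.) is dominated by a
   product of three integrable functions of one variable, so I is finite at 0;
   by dominated convergence it is continuous on [0, +oo), and it is
   nonincreasing.  Hence a root s > 0 exists iff gamma < mu^2 I(0), and it is
   then unique.  At mu = mu_l^0(gamma), mu^2 I(0) = gamma, which says that the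
   constants are fixed by G_mu; they span its eigenspace since every G_mu psi is
   constant. *)
From HB Require Import structures.
From mathcomp Require Import all_boot all_order all_algebra.
From mathcomp Require Import all_classical all_reals all_analysis.
From mathcomp Require Import measurable_realfun.
Require Import Defs.
From mathcomp Require Import complex ring lra.
Set Implicit Arguments.
Unset Strict Implicit.
Unset Printing Implicit Defensive.
Import Order.TTheory GRing.Theory Num.Theory numFieldNormedType.Exports.
Local Open Scope classical_set_scope.
Local Open Scope ring_scope.

Section spectrum.
Context {R : realType}.

(** * Measure structures on the plane and on space *)

(** Tonelli's theorem for [leb3], a product of [leb2] with a line, requires this. Growing squares
    exhaust the plane. *)
Lemma sigma_finite_leb2 : sigma_finite setT (@leb2 R).
Proof.
pose F (n : nat) := `]- n%:R, n%:R]%classic : set (measurableTypeR R).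
have mF n : measurable (F n) by exact: measurable_itv.
exists (fun n => F n `*` F n).
  apply/esym; rewrite -subTset => -[x y] _.
  exists (Num.truncn (Num.max `|x| `|y|)).+1 => //.
  have := truncnS_gt (Num.max `|x| `|y|).
  set n := _.+1; rewrite gt_max => /andP[].
  rewrite !ltr_norml => /andP[x1 x2] /andP[y1 y2].
  by split; rewrite /F/= in_itv/= ?x1 ?y1 /= ltW.
move=> n; split; first exact: measurableX.
rewrite /leb2 product_measure1E//= lebesgue_measure_itv/=.
by case: ifPn => _; rewrite ?mule0 ?ltry// -EFinB -EFinM ltry.
Qed.

HB.instance Definition _ := Measure.on (@leb2 R).
HB.instance Definition _ :=
  Measure_isSigmaFinite.Build _ _ _ (@leb2 R) sigma_finite_leb2.
HB.instance Definition _ := Measure.on (@leb3 R).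

(** * Finiteness of the integral of 1 / w_1(0,.) *)

(** Fundamental theorem of calculus with antiderivative [x ^ (p + 1) / (p + 1)]; the condition
    [0 < a] keeps away from the singularity. *)
Lemma integral_powR (p a b : R) : p + 1 != 0 -> 0 < a -> a < b ->
  (\int[@lebesgue_measure R]_(x in `[a, b]) (x `^ p)%:E =
   ((b `^ (p + 1) - a `^ (p + 1)) / (p + 1))%:E)%E.
Proof.
move=> p1 a0 ab.
have dpow q x : 0 < x -> derivable (fun y : R => y `^ q) x 1.
  by move=> x0; have [] := is_derive1_powR q x0.
have cpow q x : 0 < x -> {for x, continuous (fun y : R => y `^ q)}.
  by move=> x0; apply/differentiable_continuous/derivable1_diffP/dpow.
have gt0 x : x \in `[a, b] -> 0 < x.
  by rewrite in_itv/= => /andP[+ _]; apply: lt_le_trans.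
pose F (x : R) := (p + 1)^-1 * x `^ (p + 1).
have dF (x : R) : 0 < x -> is_derive x 1 F (x `^ p).
  move=> x0.
  have := is_deriveZ (p + 1)^-1 (is_derive1_powR (p + 1) x0).
  by rewrite addrK /GRing.scale/= mulrA mulVf// mul1r.
have cF (x : R) : 0 < x -> {for x, continuous F}.
  by move=> x0; apply/differentiable_continuous/derivable1_diffP/ex_derive/dF.
rewrite (@continuous_FTC2 _ _ F)//.
- by rewrite -EFinB /F -mulrBr mulrC.
- apply: continuous_in_subspaceT => x /[!inE] xab.
  by apply/cpow/gt0.
- split.
  + move=> x /subset_itv_oo_cc xab; exact/ex_derive/dF/gt0.
  + by apply: cvg_at_right_filter; exact: cF.
  + by apply: cvg_at_left_filter; apply: cF; exact: lt_trans ab.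
- move=> x /subset_itv_oo_cc xab; rewrite derive1E.
  by have [_ ->] := dF _ (gt0 _ xab).
Qed.

(** The punctured interval is exhausted by the sets [e n <= |x| <= b], on which the integrals stay
    below [2 * b ^ (p + 1) / (p + 1)]; monotone convergence passes the bound to the limit. *)
Lemma integral_punctured_powR_lty (p b : R) : 0 < p + 1 -> 0 < b ->
  (\int[@lebesgue_measure R]_(x in `[(- b)%R, b] `\ 0%R) (`|x| `^ p)%:E
    < +oo)%E.
Proof.
move=> p1 b0.
(* The shift by two makes [e n < b] strict already at [n = 0]. *)
pose e n : R := b / n.+2%:R.
have e_gt0 n : 0 < e n by rewrite divr_gt0.
have e_lt n : e n < b by rewrite ltr_pdivrMr// ltr_pMr// ltr1n.
pose F n : set R := `[- b, - e n]%classic `|` `[e n, b]%classic.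
have mF n : measurable (F n) by apply: measurableU; exact: measurable_itv.
have UF : `[- b, b]%classic `\ 0%R = \bigcup_n F n.
  apply/seteqP; split => x /=.
    rewrite in_itv/= -ler_norml => -[xb /eqP x0].
    have {}x0 : 0 < `|x| by rewrite normr_gt0.
    exists (Num.truncn (b / `|x|)) => //.
    have : e (Num.truncn (b / `|x|)) <= `|x|.
      rewrite ler_pdivrMr// mulrC -ler_pdivrMr//.
      by rewrite (le_trans (ltW (truncnS_gt _)))// ler_nat.
    have /andP[xb1 xb2] : - b <= x <= b by rewrite -ler_norml.
    by rewrite ler_normr lerNr => /orP[ex|ex]; [right|left];
      rewrite /= in_itv/= ex ?xb1 ?xb2.
  move=> [n _ []]; rewrite /= !in_itv/= => /andP[x1 x2].
    by split; [apply/andP; split|apply/eqP]; have := e_gt0 n; lra.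
  by split; [apply/andP; split|apply/eqP]; have := e_gt0 n; lra.
pose f (x : R) := `|x| `^ p.
have mf D : measurable_fun D (fun x => (f x)%:E).
  apply/measurable_EFinP/measurable_funTS.
  by apply: (measurableT_comp (measurable_powR p)); exact: normr_measurable.
have le n : (\int[@lebesgue_measure R]_(x in F n) (f x)%:E
    <= (2 * (b `^ (p + 1) / (p + 1)))%:E)%E.
  have b0' : 0 <= (b `^ (p + 1) - (e n) `^ (p + 1)) / (p + 1)
                <= b `^ (p + 1) / (p + 1).
    rewrite divr_ge0 ?subr_ge0 ?(ltW p1)//=.
      by rewrite ler_pM2r ?invr_gt0// lerBlDr lerDl powR_ge0.
    by apply: ge0_ler_powR => //; rewrite ?nnegrE; exact: ltW.
  have pos : (\int[@lebesgue_measure R]_(x in `[e n, b]) (f x)%:E =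
      ((b `^ (p + 1) - (e n) `^ (p + 1)) / (p + 1))%:E)%E.
    rewrite -integral_powR ?gt_eqF//; apply: eq_integral => x.
    rewrite inE/= in_itv/= => /andP[ex _].
    by rewrite /f ger0_norm// (le_trans _ ex)// ltW.
  rewrite ge0_integral_setU//=.
  (* The reflection [x -> - x] turns the negative half into the positive one, whence the factor
     2. *)
  - rewrite (integration_by_substitution_oppr (ltW (e_lt n))).
      under eq_integral do rewrite /f /= normrN.
      rewrite [X in (X + _)%E]pos pos -EFinD lee_fin mulr_natl mulr2n.
      by case/andP : b0' => _ b0'; exact: lerD.
    apply: continuous_in_subspaceT => x; rewrite inE/= in_itv/= => /andP[_ xe].
    have x0 : x < 0 by have := e_gt0 n; lra.
    apply: (@continuous_comp R R R (fun y => `|y|) (fun y => y `^ p)).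
      exact: norm_continuous.
    have x0' : 0 < `|x| by rewrite normr_gt0 lt_eqF.
    have [+ _] := is_derive1_powR p x0'.
    by move=> /derivable1_diffP/differentiable_continuous.
  - exact: mf.
  - by move=> x _; rewrite lee_fin powR_ge0.
  - rewrite disj_set2E; apply/eqP; rewrite -subset0 => x [] /=.
    rewrite !in_itv/= => /andP[_ x1] /andP[x2 _].
    by have := e_gt0 n; lra.
rewrite UF; apply: (@le_lt_trans _ _ (2 * (b `^ (p + 1) / (p + 1)))%:E);
  last exact: ltry.
have cvgF := @ge0_nondecreasing_set_cvg_integral _ (measurableTypeR R) _ F
  (fun x => (f x)%:E) (@lebesgue_measure R).
apply: (cvge_le _ (cvgF _ _ _ _)); first by apply: nearW => n; exact: le.
- apply/nondecreasing_seqP => n; apply/subsetPset => x.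
  have ee : e n.+1 <= e n.
    by rewrite ler_pM2l// lef_pV2 ?posrE// ler_nat.
  by move=> []; rewrite /= !in_itv/= => /andP[x1 x2]; [left|right];
    rewrite /= in_itv/=; apply/andP; split; lra.
- exact: mF.
- by move=> n; exact: mf.
- by move=> n x _; rewrite lee_fin powR_ge0.
Qed.

(** * Quadratic lower bound for [w1 0] on the torus *)

(** With [y = |x| / 4], [1 - cos (x / 2)] is [2 * sin y ^ 2]. Since [y <= pi / 4], the mean value
    theorem gives [sin y >= y / 2], and [2 * (y / 2) ^ 2 = x ^ 2 / 32]. *)
Lemma sqr_le_onem_cos (x : R) : `|x| <= pi -> x ^+ 2 / 32 <= 1 - cos (x / 2).
Proof.
move=> xpi; pose y : R := `|x| / 4.
have y0 : 0 <= y by rewrite divr_ge0.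
have ypi : y <= pi / 4 by rewrite ler_pM2r.
have pi0 : (0 : R) < pi := pi_gt0 R.
have cosE : cos (x / 2) = 1 - 2 * sin y ^+ 2.
  rewrite -cos_norm normrM (@ger0_norm _ 2^-1)//.
  have -> : `|x| / 2 = y *+ 2 by rewrite /y -(mulr_natl (`|x| / 4)); field.
  by rewrite cos_mulr2n -(mulr_natl (cos y ^+ 2)) cos2sin2; ring.
have xE : `|x| = 4 * y by rewrite /y; field.
clearbody y.
have [z zy sinE] : exists2 z : R, z \in `[0, y] &
    sin y - sin 0 = cos z * (y - 0).
  apply: (@MVT_segment _ sin cos) => //.
  by apply: continuous_subspaceT; exact: continuous_sin.
(* As [2 z] lies in [[0, pi / 2]], [0 <= cos (2 z) = 2 * cos z ^ 2 - 1], so [cos z ^ 2 >= 1 / 2]. *)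
have cosz : 1 / 2 <= cos z.
  move: zy; rewrite in_itv/= => /andP[z0 zy].
  have c0 : 0 <= cos z.
    apply: cos_ge0_pihalf; apply/andP; split. lra. lra.
  have : 0 <= cos (z *+ 2).
    by apply: cos_ge0_pihalf; rewrite -(mulr_natl z); apply/andP; split; lra.
  by rewrite cos_mulr2n -(mulr_natl (cos z ^+ 2)); nra.
have siny : y / 2 <= sin y.
  move: sinE; rewrite sin0 !subr0 => ->.
  by rewrite mulrC; apply: ler_wpM2r => //; lra.
have : y ^+ 2 / 4 <= sin y ^+ 2 by nra.
rewrite cosE -(real_normK (num_real x)).
rewrite xE.
by lra.
Qed.

(** Tonelli for separated variables, with extended real values because the dominating weight is
    infinite at 0. Two uses of it factor the triple integral. *)
Lemma ge0_integral_prodM d1 d2 (T1 : measurableType d1) (T2 : measurableType d2)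
    (m1 : {sigma_finite_measure set T1 -> \bar R})
    (m2 : {sigma_finite_measure set T2 -> \bar R})
    (f : T1 -> \bar R) (g : T2 -> \bar R) :
  measurable_fun setT f -> measurable_fun setT g ->
  (forall x, 0 <= f x)%E -> (forall y, 0 <= g y)%E ->
  (\int[m1 \x m2]_z (f z.1 * g z.2) = \int[m1]_x f x * \int[m2]_y g y)%E.
Proof.
move=> mf mg f0 g0; rewrite fubini_tonelli1/=.
- rewrite -ge0_integralZr//; last exact: integral_ge0.
  apply: eq_integral => x _; rewrite /fubini_F/= ge0_integralZl//.
- apply: emeasurable_funM.
    exact: (measurableT_comp mf measurable_fst).
  exact: (measurableT_comp mg measurable_snd).
- by move=> z; exact: mule_ge0.
Qed.

Lemma onem_cos_ge0 (x : R) : 0 <= 1 - cos x.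
Proof. by rewrite subr_ge0 cos_le1. Qed.

Lemma eps_ge0 (t : R * R * R) : 0 <= eps t.
Proof. by apply: addr_ge0; [apply: addr_ge0|]; exact: onem_cos_ge0. Qed.

(** Identifies [w1 0] with the denominator in the kernel of [G]. *)
Lemma w1_0E (t : R * R * R) : w1 0 t = eps (half t) + eps t.
Proof.
by rewrite /w1 [in X in X + _ + _]/eps /= cos0 subrr !add0r.
Qed.

Lemma w1_0_ge0 (t : R * R * R) : 0 <= w1 0 t.
Proof. by rewrite w1_0E addr_ge0 ?eps_ge0. Qed.

Lemma w1_0_le (t : R * R * R) : w1 0 t <= 12.
Proof.
rewrite w1_0E /eps /half /=.
have := cos_geN1 t.1.1; have := cos_geN1 t.1.2; have := cos_geN1 t.2.
have := cos_geN1 (t.1.1 / 2); have := cos_geN1 (t.1.2 / 2).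
by have := cos_geN1 (t.2 / 2); lra.
Qed.

Lemma T3_norm (t : R * R * R) : T3 t ->
  [/\ `|t.1.1| <= pi, `|t.1.2| <= pi & `|t.2| <= pi].
Proof.
by move=> [[]] /=; rewrite !in_itv/= !ler_norml => /andP[/ltW-> ->]
  /andP[/ltW-> ->] /andP[/ltW-> ->].
Qed.

Lemma sqr_le_w1_0 (t : R * R * R) : T3 t ->
  (t.1.1 ^+ 2 + t.1.2 ^+ 2 + t.2 ^+ 2) / 32 <= w1 0 t.
Proof.
move=> /T3_norm[/sqr_le_onem_cos h1 /sqr_le_onem_cos h2 /sqr_le_onem_cos h3].
by rewrite w1_0E; have := eps_ge0 t; rewrite {2}/eps /half/=; lra.
Qed.

Lemma w1_0_gt0 (t : R * R * R) : T3 t -> t != 0 -> 0 < w1 0 t.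
Proof.
move=> Tt t0; have := sqr_le_w1_0 Tt; apply: lt_le_trans.
rewrite divr_gt0// lt_neqAle !addr_ge0 ?sqr_ge0// andbT eq_sym.
apply: contraNneq t0 => /eqP.
rewrite !paddr_eq0 ?addr_ge0 ?sqr_ge0// !sqrf_eq0 => /andP[/andP[]].
by case: t {Tt} => [[x y] z] /= /eqP-> /eqP-> /eqP->.
Qed.

(* The value +oo at 0 makes the domination of 1 / w_1(0,.) hold at every point
   of T3, including the coordinate planes, where `|0| `^ (- (2 / 3)) is 0. *)
Definition singular_weight (x : R) : \bar R :=
  if x == 0 then +oo%E else (`|x| `^ (- (2 / 3)))%:E.

Lemma singular_weight_gt0 (x : R) : (0 < singular_weight x)%E.
Proof.
rewrite /singular_weight; case: ifPn => [_|x0]; first exact: ltry.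
by rewrite lte_fin powR_gt0 ?normr_gt0.
Qed.

Lemma measurable_singular_weight : measurable_fun setT singular_weight.
Proof.
apply: measurable_fun_ifT => //.
- apply: (measurable_fun_bool true).
  rewrite setTI (_ : _ @^-1` _ = [set 0]); first exact: measurable_set1.
  by apply/seteqP; split => x /= /eqP.
- apply/measurable_EFinP.
  apply: (measurableT_comp (measurable_powR (- (2 / 3)))).
  exact: normr_measurable.
Qed.

(** The infinite value sits on the null set [[set 0]]; elsewhere the exponent [- (2 / 3)] exceeds
    -1. *)
Lemma integral_singular_weight_lty :
  (\int[@lebesgue_measure R]_(x in `[(- pi)%R, pi]) singular_weight x < +oo)%E.
Proof.
have pi0 : (0 : R) < pi := pi_gt0 R.
have -> : `[(- pi)%R, pi]%classic =
    (`[(- pi)%R, pi]%classic `\ (0 : R)) `|` [set 0].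
  rewrite setUC setD1K//= in_itv/= oppr_le0 !ltW//.
rewrite ge0_integral_setU//=.
- rewrite integral_set1 adde0.
  apply: le_lt_trans (@integral_punctured_powR_lty (- (2 / 3)) pi _ _) => //.
    rewrite le_eqVlt; apply/orP; left; apply/eqP; apply: eq_integral => x.
    by rewrite inE/= /singular_weight => -[_ /eqP/negPf->].
  by lra.

- by apply: measurableD => //; exact: measurable_set1.
- exact: measurable_funTS measurable_singular_weight.
- by move=> x _; exact/ltW/singular_weight_gt0.
- by rewrite disj_set2E; apply/eqP; rewrite -subset0 => x [[]].
Qed.

(** A weak form of the arithmetic-geometric mean inequality, from the factorization of
    [a ^ 3 + b ^ 3 + c ^ 3 - 3 a b c]. *)
Lemma prod3_le_sum_cube (a b c : R) : 0 <= a -> 0 <= b -> 0 <= c ->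
  a * b * c <= a ^+ 3 + b ^+ 3 + c ^+ 3.
Proof.
move=> a0 b0 c0.
have abc0 : 0 <= a * b * c by rewrite !mulr_ge0.
have : 0 <= (a + b + c) * ((a - b) ^+ 2 + (b - c) ^+ 2 + (c - a) ^+ 2).
  by rewrite mulr_ge0// !addr_ge0// sqr_ge0.
have -> : (a + b + c) * ((a - b) ^+ 2 + (b - c) ^+ 2 + (c - a) ^+ 2) =
  2 * (a ^+ 3 + b ^+ 3 + c ^+ 3 - 3 * (a * b * c)) by ring.
by lra.
Qed.

Lemma powR23_cube (x : R) : (`|x| `^ (2 / 3)) ^+ 3 = x ^+ 2.
Proof.
rewrite -powR_mulrn ?powR_ge0// -powRrM divfK// -[RHS]real_normK ?num_real//.
by rewrite powR_mulrn.
Qed.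

(** The cube inequality at [|x| ^ (2 / 3)], [|y| ^ (2 / 3)], [|z| ^ (2 / 3)] bounds their product by
    [x ^ 2 + y ^ 2 + z ^ 2 <= 32 * w1 0 t]. Sharing the singularity of order 2 among three variables
    leaves the integrable exponent [2 / 3] in each. *)
Lemma inv_w1_0_le (t : R * R * R) : T3 t ->
  (((w1 0 t)^-1)%:E <= singular_weight t.1.1 * singular_weight t.1.2 *
     (32%:E * singular_weight t.2))%E.
Proof.
move=> Tt; have := sqr_le_w1_0 Tt; case: t Tt => [[x y] z] _ /=.
set w := w1 _ _ => wE.
have pos32 u : (0 < 32%:E * singular_weight u)%E.
  by rewrite mule_gt0 ?lte_fin// singular_weight_gt0.
have gt0 := singular_weight_gt0.
(* On a coordinate plane one weight is infinite and the other factors are positive, so the majorant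
   is [+oo]. *)
have [->|x0] := eqVneq x 0.
  by rewrite {1}/singular_weight eqxx gt0_mulye// gt0_mulye// leey.
have [->|y0] := eqVneq y 0.
  by rewrite {2}/singular_weight eqxx gt0_muley// gt0_mulye// leey.
have [->|z0] := eqVneq z 0.
  rewrite {3}/singular_weight eqxx gt0_muley ?lte_fin//.
  by rewrite gt0_muley ?mule_gt0// leey.
rewrite /singular_weight (negPf x0) (negPf y0) (negPf z0) -!EFinM lee_fin.
have := @prod3_le_sum_cube (`|x| `^ (2 / 3)) (`|y| `^ (2 / 3))
  (`|z| `^ (2 / 3)) (powR_ge0 _ _) (powR_ge0 _ _) (powR_ge0 _ _).
rewrite !powR23_cube !powRN.
have gt0' (u : R) : u != 0 -> 0 < `|u| `^ (2 / 3).
  by move=> u0; rewrite powR_gt0 ?normr_gt0.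
move: (gt0' _ x0) (gt0' _ y0) (gt0' _ z0).
set a := `|x| `^ _; set b := `|y| `^ _; set c := `|z| `^ _ => a0 b0 c0 abc.
have -> : a^-1 * b^-1 * (32 * c^-1) = (a * b * c / 32)^-1.
  by field; rewrite !gt_eqF.
have abc0 : 0 < a * b * c / 32 by rewrite divr_gt0// !mulr_gt0.
rewrite lef_pV2 ?posrE//; last by apply: lt_le_trans wE; lra.
by lra.
Qed.

(** * Measurability and integrability on the torus *)

Local Notation R3 :=
  (measurableTypeR R * measurableTypeR R * measurableTypeR R)%type.

Lemma measurable_T3 : measurable (@T3 R : set R3).
Proof. by apply: measurableX => //; apply: measurableX. Qed.

Lemma measurable_w1_0 (D : set R3) :
  measurable_fun D (w1 (0 : R * R * R) : R3 -> R).
Proof.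
apply: measurable_funTS.
have mcos (f : R3 -> R) : measurable_fun setT f ->
    measurable_fun setT (fun t => 1 - cos (f t)).
  move=> mf; apply: measurable_funB => //.
  apply: measurableT_comp mf.
  by apply: continuous_measurable_fun; exact: continuous_cos.
have m11 : measurable_fun setT (fun t : R3 => t.1.1).
  exact: (measurableT_comp measurable_fst measurable_fst).
have m12 : measurable_fun setT (fun t : R3 => t.1.2).
  exact: (measurableT_comp measurable_snd measurable_fst).
have m2 : measurable_fun setT (fun t : R3 => t.2).
  exact: measurable_snd.
have mhalf (f : R3 -> R) : measurable_fun setT f ->
    measurable_fun setT (fun t => f t / 2).
  by move=> mf; apply: measurable_funM.
rewrite (_ : w1 0 = fun t => eps (half t) + eps t); last exact/funext/w1_0E.
by apply: measurable_funD;
  (apply: measurable_funD; first apply: measurable_funD);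
  apply: mcos => //; exact: mhalf.
Qed.

Lemma measurable_inv_w1_0 (D : set R3) (s : R) : 0 <= s ->
  measurable_fun D (fun t : R3 => (w1 0 t + s)^-1).
Proof.
move=> s0; rewrite (_ : (fun t => _) = fun t => (w1 0 t + s) `^ (-1)).
  apply: (measurableT_comp (measurable_powR (-1))).
  by apply: measurable_funD => //; exact: measurable_w1_0.
by apply/funext => t; rewrite powR_inv1 // addr_ge0 ?w1_0_ge0.
Qed.

Lemma integral_T3_singular_weight_lty :
  (\int[@leb3 R]_(t in @T3 R) (singular_weight t.1.1 * singular_weight t.1.2 *
     (32%:E * singular_weight t.2)) < +oo)%E.
Proof.
(* Cutting the weight off outside [[- pi, pi]] allows integration over the whole space, where the
   integral factors. *)
pose h : R -> \bar R := singular_weight \_ `[- pi, pi].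
have h0 x : (0 <= h x)%E.
  by apply: erestrict_ge0 => ? _; exact/ltW/singular_weight_gt0.
have mh : measurable_fun setT h.
  apply/(measurable_restrictT _ _).1 => //.
  exact: measurable_funTS measurable_singular_weight.
have mh32 : measurable_fun setT (fun x => 32%:E * h x)%E.
  by apply: emeasurable_funM.
have ih : (\int[@lebesgue_measure R]_x h x < +oo)%E.
  by rewrite -integral_mkcond; exact: integral_singular_weight_lty.
have ih0 : (0 <= \int[@lebesgue_measure R]_x h x)%E by exact: integral_ge0.
pose g (u : measurableTypeR R * measurableTypeR R) := (h u.1 * h u.2)%E.
have g0 u : (0 <= g u)%E by exact: mule_ge0.
have mg : measurable_fun setT g.
  apply: emeasurable_funM.
    exact: (measurableT_comp mh measurable_fst).
  exact: (measurableT_comp mh measurable_snd).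
have iH : (\int[@leb3 R]_t (g t.1 * (32%:E * h t.2)) < +oo)%E.
  have := @ge0_integral_prodM _ _ _ _ (@leb2 R) (@lebesgue_measure R) g
    (fun x => 32%:E * h x)%E mg mh32 g0 _.
  rewrite /leb3 => ->; last by move=> y; rewrite mule_ge0.
  rewrite [X in (X * _)%E](ge0_integral_prodM (@lebesgue_measure R)
    (@lebesgue_measure R) mh mh h0 h0).
  rewrite ge0_integralZl//.
  have fih : (\int[@lebesgue_measure R]_x h x)%E \is a fin_num.
    by rewrite ge0_fin_numE.
  rewrite -(fineK fih) -!EFinM; exact: ltry.
apply: le_lt_trans iH.
have mG : measurable_fun setT (fun t : R * R * R => g t.1 * (32%:E * h t.2))%E.
  apply: emeasurable_funM.
    exact: (measurableT_comp mg measurable_fst).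
  exact: (measurableT_comp mh32 measurable_snd).
have hE (x : R) : `|x| <= pi -> h x = singular_weight x.
  by rewrite ler_norml => xpi; rewrite /h patchE mem_set//= in_itv.
rewrite (_ : \int[_]_(t in _) _ =
    \int[@leb3 R]_(t in @T3 R) (g t.1 * (32%:E * h t.2)))%E.
  apply: ge0_subset_integral => //; first exact: measurable_T3.
  by move=> t _; rewrite mule_ge0// mule_ge0.
apply: eq_integral => t /[!inE] /T3_norm[t1 t2 t3].
by rewrite /g !hE.
Qed.

Lemma integrable_inv_w1_0 :
  (@leb3 R).-integrable (@T3 R) (fun t => ((w1 0 t)^-1)%:E).
Proof.
have minv : measurable_fun (@T3 R) (fun t => (w1 0 t)^-1).
  have := @measurable_inv_w1_0 (@T3 R) 0 (lexx 0).
  by under eq_fun do rewrite addr0.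
apply/integrableP; split; first exact/measurable_EFinP.
apply: le_lt_trans integral_T3_singular_weight_lty.
apply: ge0_le_integral => //.
- exact: measurable_T3.
- by apply/measurable_EFinP; apply: measurableT_comp.
- apply: measurable_funTS; apply: emeasurable_funM.
    apply: emeasurable_funM;
      apply: (measurableT_comp measurable_singular_weight).
      exact: (measurableT_comp measurable_fst measurable_fst).
    exact: (measurableT_comp measurable_snd measurable_fst).
  apply: emeasurable_funM => //.
  exact: (measurableT_comp measurable_singular_weight measurable_snd).
- move=> t Tt; rewrite gee0_abs ?lee_fin ?invr_ge0 ?w1_0_ge0//.
  exact: inv_w1_0_le.
Qed.

(** * The integral I(s) *)

Lemma leb3_setX (A B C : set (measurableTypeR R)) :
  measurable A -> measurable B -> measurable C ->
  @leb3 R ((A `*` B) `*` C) =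
  (@lebesgue_measure R A * @lebesgue_measure R B * @lebesgue_measure R C)%E.
Proof.
move=> mA mB mC; rewrite /leb3 product_measure1E//; last exact: measurableX.
by rewrite [X in (X * _)%E](product_measure1E _ _ mA mB).
Qed.

Lemma leb3_T3 : @leb3 R (@T3 R) = ((2 * pi) ^+ 3)%:E.
Proof.
have pi0 : (0 : R) < pi := pi_gt0 R.
rewrite leb3_setX// lebesgue_measure_itv/= lte_fin.
rewrite ifT; last by lra.
by rewrite -EFinB -!EFinM; congr EFin; ring.
Qed.

(** The origin is the only zero of [w1 0] on the torus. There the convention [0^-1 = 0] breaks the
    expected comparisons of inverses, which therefore hold only almost everywhere. *)
Lemma ae_w1_0_gt0 (P : R3 -> Prop) : (forall t, T3 t -> 0 < w1 0 t -> P t) ->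
  {ae @leb3 R, forall t, T3 t -> P t}.
Proof.
move=> TP; exists (([set 0] `*` [set 0]) `*` [set 0]); split.
- by apply: measurableX => //; apply: measurableX.
- rewrite leb3_setX//.
  by rewrite lebesgue_measure_set1 !mule0.
- move=> t /= /not_implyP[Tt]; apply: contra_notP => t0.
  apply/TP/w1_0_gt0 => //; apply: contra_notN t0 => /eqP ->.
  by [].
Qed.

Lemma integrable_T3_bounded (f : R3 -> R) (M : R) :
  measurable_fun (@T3 R : set R3) f -> (forall t, T3 t -> `|f t| <= M) ->
  (@leb3 R).-integrable (@T3 R) (fun t => (f t)%:E).
Proof.
move=> mf fM; have mT := measurable_T3.
apply/integrableP; split; first exact/measurable_EFinP.
apply: (@le_lt_trans _ _ (\int[@leb3 R]_(t in @T3 R) M%:E)%E).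
  apply: ge0_le_integral => //.
  by apply/measurable_EFinP; apply: measurableT_comp.
rewrite integral_cst//= leb3_T3 -EFinM; exact: ltry.
Qed.

(* The absolute value makes the integrand, hence the integral, continuous in s
   on the whole line, so that s = 0 is not a boundary point. *)
Definition green (s : R) (t : R * R * R) : R := (w1 0 t + `|s|)^-1.

Definition green_integral (s : R) : R := \int[@leb3 R]_(t in @T3 R) green s t.

Lemma green_ge0 s t : 0 <= green s t.
Proof. by rewrite invr_ge0 addr_ge0 ?w1_0_ge0. Qed.

Lemma measurable_green (D : set R3) s : measurable_fun D (green s : R3 -> R).
Proof. exact: measurable_inv_w1_0. Qed.

Lemma green_le s t : s != 0 -> green s t <= `|s|^-1.
Proof.
move=> s0; have s0' : 0 < `|s| by rewrite normr_gt0.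
by rewrite lef_pV2 ?posrE ?ltr_wpDl ?w1_0_ge0// lerDr w1_0_ge0.
Qed.

(** Only [s = 0] involves the singularity; otherwise [green s] is bounded by [|s|^-1] on a set of
    finite measure. *)
Lemma integrable_green s :
  (@leb3 R).-integrable (@T3 R) (fun t => (green s t)%:E).
Proof.
have [->|s0] := eqVneq s 0.
  rewrite /green normr0; under eq_fun do rewrite addr0.
  exact: integrable_inv_w1_0.
apply: (integrable_T3_bounded (M := `|s|^-1)); first exact: measurable_green.
by move=> t _; rewrite ger0_norm ?green_ge0// green_le.
Qed.

Lemma green_integral_fin_num (s : R) :
  (\int[@leb3 R]_(t in @T3 R) (green s t)%:E)%E \is a fin_num.
Proof. exact: (integrable_fin_num measurable_T3 (integrable_green s)). Qed.

Lemma green_integral_nonincreasing (s s' : R) : 0 <= s <= s' ->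
  green_integral s' <= green_integral s.
Proof.
move=> /andP[s0 ss']; have mT := measurable_T3.
apply: fine_le; [exact: green_integral_fin_num|exact: green_integral_fin_num|].
apply: (@ae_ge0_le_integral _ _ _ (@leb3 R) _ mT) => //.
- by move=> t _; rewrite lee_fin green_ge0.
- by apply/measurable_EFinP; exact: measurable_green.
- by move=> t _; rewrite lee_fin green_ge0.
- by apply/measurable_EFinP; exact: measurable_green.
apply: ae_w1_0_gt0 => t Tt w0.
have p u : 0 < w1 0 t + `|u : R| by exact: ltr_wpDr.
rewrite lee_fin /green lef_pV2 ?posrE ?p//.
by rewrite lerD2l !ger0_norm// (le_trans s0).
Qed.

(** The six cosine terms give [w1 0 <= 12], hence [green s >= (12 + |s|)^-1] almost everywhere on a
    set of positive measure. *)
Lemma green_integral_gt0 s : 0 < green_integral s.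
Proof.
have mT := measurable_T3; have pi0 : (0 : R) < pi := pi_gt0 R.
have c0 : 0 < 12 + `|s| by rewrite ltr_wpDr.
apply: (@lt_le_trans _ _ (\int[@leb3 R]_(t in @T3 R) (12 + `|s|)^-1)).
  rewrite Rintegral_cst// [X in fine X]leb3_T3/=.
  by rewrite mulr_gt0 ?invr_gt0 ?exprn_gt0 ?mulr_gt0.
apply: fine_le.
- by rewrite integral_cst//= leb3_T3.
- exact: green_integral_fin_num.
apply: (@ae_ge0_le_integral _ _ _ (@leb3 R) _ mT) => //.
- by move=> t _; rewrite lee_fin green_ge0.
- by apply/measurable_EFinP; exact: measurable_green.
apply: ae_w1_0_gt0 => t Tt w0.
have p : 0 < w1 0 t + `|s| by exact: ltr_wpDr.
by rewrite lee_fin lef_pV2 ?posrE ?p// lerD2r w1_0_le.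
Qed.

(** Dominated convergence with the majorant [(w1 0 t)^-1], which serves all [s] at once. *)
Lemma continuous_green_integral : continuous green_integral.
Proof.
move=> s; have mT := measurable_T3.
have sI : s \in (`]s - 1, s + 1[%classic : set R).
  by rewrite inE/= in_itv/=; apply/andP; split; lra.
apply: (continuity_under_integral mT _ _ integrable_inv_w1_0 _ sI).
- by move=> u _; exact: integrable_green.
- apply: ae_w1_0_gt0 => t Tt w0 u _.
  apply: cvgV; first by rewrite gt_eqF//; exact: ltr_wpDr.
  by apply: cvgD; [exact: cvg_cst|exact: norm_continuous].
- move=> u _; apply: ae_w1_0_gt0 => t Tt w0.
  have p : 0 < w1 0 t + `|u| by exact: ltr_wpDr.
  rewrite ger0_norm ?green_ge0// lef_pV2 ?posrE//.
  by rewrite lerDl.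
Qed.

Lemma green_integral0 :
  \int[@leb3 R]_(t in @T3 R) (w1 0 t)^-1 = green_integral 0.
Proof. by apply: eq_Rintegral => t _; rewrite /green normr0 addr0. Qed.

(** * Secular equation and eigenvalues *)

Lemma secular_root_exists (gamma mu : R) : gamma < mu ^+ 2 * green_integral 0 ->
  exists2 s, 0 < s & gamma + s = mu ^+ 2 * green_integral s.
Proof.
move=> gm; pose h s := gamma + s - mu ^+ 2 * green_integral s.
have ch : continuous h.
  move=> s; apply: cvgB.
    by apply: cvgD; [exact: cvg_cst|exact: cvg_id].
  by apply: cvgM; [exact: cvg_cst|exact: continuous_green_integral].
(* With this [b], [h b = mu ^ 2 * (green_integral 0 - green_integral b)], which is nonnegative by
   monotonicity. *)
pose b := mu ^+ 2 * green_integral 0 - gamma.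
have b0 : 0 < b by rewrite /b subr_gt0.
have hb : 0 <= h b.
  have : mu ^+ 2 * green_integral b <= mu ^+ 2 * green_integral 0.
    apply: ler_wpM2l; first exact: sqr_ge0.
    by apply: green_integral_nonincreasing; rewrite lexx ltW.
  by rewrite /h /b; lra.
have h0 : h 0 < 0 by rewrite /h addr0 subr_lt0.
have [s] : exists2 s : R, s \in `[0, b] & h s = 0.
  apply: IVT; [exact: ltW|exact: continuous_subspaceT|].
  by rewrite ge_min (ltW h0) le_max hb orbT.
rewrite in_itv/= => /andP[s0 _] hs; exists s.
  rewrite lt_neqAle s0 andbT; apply: contraTneq h0 => s0'.
  by move: hs; rewrite -s0' => ->; rewrite ltxx.
by move: hs; rewrite /h; lra.
Qed.

(** The left side is strictly increasing in [s] and the right side nonincreasing. *)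
Lemma secular_root_unique (gamma mu s s' : R) : 0 < s -> 0 < s' ->
  gamma + s = mu ^+ 2 * green_integral s ->
  gamma + s' = mu ^+ 2 * green_integral s' -> s = s'.
Proof.
wlog ss' : s s' / s <= s' => [hwlog s0 s0' e e'|].
  by have [/hwlog|/ltW/hwlog h] := leP s s'; [exact|rewrite h].
move=> s0 s0' e e'; apply/eqP; rewrite eq_le ss'/=.
have : mu ^+ 2 * green_integral s' <= mu ^+ 2 * green_integral s.
  apply: ler_wpM2l; first exact: sqr_ge0.
  by apply: green_integral_nonincreasing; rewrite (ltW s0).
by lra.
Qed.

Lemma secular_root_lt (gamma mu s : R) : 0 < s ->
  gamma + s = mu ^+ 2 * green_integral s -> gamma < mu ^+ 2 * green_integral 0.
Proof.
move=> s0 e.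
have : mu ^+ 2 * green_integral s <= mu ^+ 2 * green_integral 0.
  apply: ler_wpM2l; first exact: sqr_ge0.
  by apply: green_integral_nonincreasing; rewrite lexx ltW.
by lra.
Qed.

(** Evaluates the integral of [f_1] once the second eigenvalue equation is solved, separately for
    real and imaginary parts. *)
Lemma Rintegral_ae_green (f : R3 -> R) (c s : R) :
  measurable_fun (@T3 R : set R3) f ->
  {ae @leb3 R, forall t, T3 t -> f t = c * green s t} ->
  \int[@leb3 R]_(t in @T3 R) f t = c * green_integral s.
Proof.
move=> mf fE; have mT := measurable_T3.
rewrite -(RintegralZl c mT (integrable_green s)); congr fine.
apply: (@ae_eq_integral _ _ _ (@leb3 R) _ _ _ mT).
- by apply/measurable_EFinP.
- apply/measurable_EFinP; apply: measurable_funM => //.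
  exact: measurable_green.
- by move: fE => [N [mN N0 sN]]; exists N; split => // t /= nt; apply: sN => /=;
    apply: contra_not nt => h Tt; rewrite h.
Qed.

Local Open Scope complex_scope.

Lemma Re_realM (x : R) (z : R[i]) : complex.Re (x%:C * z) = x * complex.Re z.
Proof. by case: z => a b /=; rewrite mul0r subr0. Qed.

Lemma Im_realM (x : R) (z : R[i]) : complex.Im (x%:C * z) = x * complex.Im z.
Proof. by case: z => a b /=; rewrite mul0r addr0. Qed.

Lemma w0_0E (gamma : R) : w0 gamma 0 = gamma.
Proof. by rewrite /w0 /eps /= cos0 subrr !add0r. Qed.

Lemma w1_0D_neq0 (s : R) t : 0 < s -> w1 0 t + s != 0.
Proof. by move=> s0; rewrite gt_eqF// ltr_wpDl// w1_0_ge0. Qed.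

(** For an eigenvector, [f_0 = 0] would force [f_1 = 0] almost everywhere, so [f_0] can be
    cancelled. Conversely, a root [s] yields the eigenvector with [f_0 = 1] and
    [f_1 = - mu * green s]. *)
Lemma negative_eigenvalueP (gamma mu : R) (z : R[i]) :
  negative_eigenvalue (A gamma mu 0) z <->
  exists s : R,
    [/\ 0 < s, z = (- s)%:C & gamma + s = mu ^+ 2 * green_integral s].
Proof.
split=> [[]|[s [s0 -> secular]]].
  case: z => x y; rewrite ltcE/= => /andP[/eqP <-{y} x0] [[[a b] f]].
  have [s xE] : exists s, x = - s by exists (- x); rewrite opprK.
  subst x; have {x0}s0 : 0 < s by rewrite -oppr_lt0.
  move=> [[/= mRe mIm _] nz [/= e1 e2]].
  have fRe t : mu%:C * (a +i* b) + (w1 0 t)%:C * f t = (- s)%:C * f t ->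
      complex.Re (f t) = - mu * a * green s t.
    move=> /(congr1 (@complex.Re R)); rewrite raddfD/= !Re_realM/= => e.
    rewrite /green gtr0_norm//; apply: (canRL (mulfK (w1_0D_neq0 t s0))).
    by lra.
  have fIm t : mu%:C * (a +i* b) + (w1 0 t)%:C * f t = (- s)%:C * f t ->
      complex.Im (f t) = - mu * b * green s t.
    move=> /(congr1 (@complex.Im R)); rewrite raddfD/= !Im_realM/= => e.
    rewrite /green gtr0_norm//; apply: (canRL (mulfK (w1_0D_neq0 t s0))).
    by lra.
  (* Outside the null set [N] the second equation holds pointwise, so all its pointwise consequences
     hold almost everywhere. *)
  have [N [mN N0 sN]] := e2.
  have aeP (P : R3 -> Prop) : (forall t, T3 t ->
      mu%:C * (a +i* b) + (w1 0 t)%:C * f t = (- s)%:C * f t -> P t) ->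
      {ae @leb3 R, forall t, T3 t -> P t}.
    move=> h; exists N; split => // t /= nP; apply: sN => /= e.
    by apply: nP => Tt; apply: h => //; exact: e.
  have iRe := Rintegral_ae_green mRe (aeP _ (fun t _ => fRe t)).
  have iIm := Rintegral_ae_green mIm (aeP _ (fun t _ => fIm t)).
  have eRe : (gamma + s - mu ^+ 2 * green_integral s) * a = 0.
    move: (congr1 (@complex.Re R) e1); rewrite raddfD !Re_realM/= iRe w0_0E.
    by move=> e; lra.
  have eIm : (gamma + s - mu ^+ 2 * green_integral s) * b = 0.
    move: (congr1 (@complex.Im R) e1); rewrite raddfD !Im_realM/= iIm w0_0E.
    by move=> e; lra.
  exists s; split => //; apply/eqP; rewrite -subr_eq0; apply/negP => /negP D0.
  apply: nz; move: eRe eIm => /eqP + /eqP; rewrite !mulf_eq0 (negPf D0)/=.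
  move=> /eqP a0 /eqP b0; subst a b; split => //.
  apply: aeP => t _ e; apply/eqP; rewrite eq_complex/=.
  by rewrite (fRe _ e) (fIm _ e) !mulr0 !mul0r eqxx.
split; first by rewrite ltcE/= eqxx oppr_lt0.
pose f t := (- mu * green s t)%:C.
have mg : measurable_fun (@T3 R : set R3) (fun t => - mu * green s t : R).
  by apply: measurable_funM => //; exact: measurable_green.
have cf : cintegral f = (- mu * green_integral s)%:C.
  rewrite /cintegral /f /=; congr (_ +i* _).
    exact: (RintegralZl _ measurable_T3 (integrable_green s)).
  by rewrite (Rintegral_cst _ measurable_T3) mul0r.
exists (1, f); split.
- split => //=.
  apply: (integrable_lty measurable_T3).
  (* The bound comes from [green s <= s^-1]. *)
  apply: (integrable_T3_bounded (M := (mu / s) ^+ 2)).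
    by apply: measurable_funD => //; exact: measurable_funX.
  move=> t _; rewrite expr0n/= addr0 mulNr sqrrN ger0_norm ?sqr_ge0// !exprMn.
  apply: ler_wpM2l; first exact: sqr_ge0.
  rewrite ler_pXn2r ?nnegrE ?green_ge0 ?invr_ge0 ?(ltW s0)//.
  by have := green_le t (lt0r_neq0 s0); rewrite gtr0_norm.
- by move=> [/= /eqP]; rewrite oner_eq0.
- split => /=.
    rewrite cf !mulr1 w0_0E -rmorphM -rmorphD/=; congr (_ +i* _).
    by lra.
  apply: ae_w1_0_gt0 => t _ _ /=.
  rewrite /f mulr1 -!rmorphM -rmorphD/=; congr (_ +i* _).
  have := w1_0D_neq0 t s0; rewrite /green gtr0_norm// => ?.
  by field.
Qed.

Lemma negative_eigenvalue_unique (gamma mu : R) :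
  gamma < mu ^+ 2 * green_integral 0 ->
  exists! z : R[i], negative_eigenvalue (A gamma mu 0) z.
Proof.
move=> /secular_root_exists[s s0 e]; exists (- s)%:C; split.
  by apply/negative_eigenvalueP; exists s.
move=> _ /negative_eigenvalueP[s' [s0' -> e']].
by rewrite (secular_root_unique s0 s0' e e').
Qed.

(** * The critical coupling and the virtual level *)

Lemma mu_l0_ge0 (gamma : R) : 0 <= mu_l0 gamma.
Proof. by rewrite mulr_ge0 ?invr_ge0 ?sqrtr_ge0. Qed.

(** Translates comparisons of [mu] with [mu_l0 gamma] into comparisons of
    [mu ^ 2 * green_integral 0] with [gamma]. *)
Lemma sqr_mu_l0 (gamma : R) : 0 < gamma ->
  mu_l0 gamma ^+ 2 * green_integral 0 = gamma.
Proof.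
move=> g0; have G0 := green_integral_gt0 0.
rewrite /mu_l0 green_integral0 exprMn exprVn !sqr_sqrtr ?ltW//.
by rewrite divfK// gt_eqF.
Qed.

Lemma virtual_level0_mu_l0 (gamma : R) : 0 < gamma ->
  virtual_level0 gamma (mu_l0 gamma).
Proof.
move=> g0; split=> [|psi [_ psi0 psiE]].
  exists (fun=> 1); split.
  - by split; first exact: cst_continuous.
  - by move=> /(congr1 (@^~ 0)) /eqP; rewrite oner_eq0.
  - have G0 := green_integral_gt0 0.
    apply/funext => q; rewrite /G (_ : cintegral _ = (green_integral 0)%:C).
      by rewrite -rmorphM/= mulrAC sqr_mu_l0// divff// gt_eqF.
    rewrite (_ : (fun t => _) = fun t => ((w1 0 t)^-1)%:C).
      rewrite /cintegral /= green_integral0; congr (_ +i* _).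
      by rewrite (Rintegral_cst _ measurable_T3) mul0r.
    by apply/funext => t; rewrite div1r -w1_0E fmorphV.
(* A fixed point of [G] is constant, so vanishing at the origin would make it zero. *)
have psiC q : psi q = psi 0 by rewrite -[in LHS]psiE -[in RHS]psiE.
by apply/eqP => psi00; apply: psi0; apply/funext => q; rewrite psiC.
Qed.

End spectrum.

Theorem theorem3p5 (R : realType) (gamma : R) :
  (gamma <= 0 -> forall mu : R, 0 < mu ->
     exists! z : R[i], negative_eigenvalue (A gamma mu 0) z) /\
  (0 < gamma ->
     [/\ forall mu : R, 0 < mu < mu_l0 gamma ->
           ~ exists z : R[i], negative_eigenvalue (A gamma mu 0) z,
         forall mu : R, mu = mu_l0 gamma -> virtual_level0 gamma mu
       & forall mu : R, mu_l0 gamma < mu ->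
           exists! z : R[i], negative_eigenvalue (A gamma mu 0) z]).
Proof.
have G0 := green_integral_gt0 (0 : R).
split=> [g0 mu mu0|g0].
  apply: negative_eigenvalue_unique; apply: le_lt_trans g0 _.
  by rewrite mulr_gt0// exprn_gt0.
split=> [mu /andP[mu0 muE] [z /negative_eigenvalueP[s [s0 _ e]]]|mu ->|mu muE].
(* A root would force [gamma < mu ^ 2 * green_integral 0], whereas [mu < mu_l0 gamma] bounds the
   right side by [gamma]. *)
- have := secular_root_lt s0 e; apply/negP; rewrite -leNgt.
  rewrite -[leRHS](sqr_mu_l0 g0).
  by rewrite ler_pM2r// ler_pXn2r ?nnegrE ?mu_l0_ge0 ?ltW.
- exact: virtual_level0_mu_l0.
- apply: negative_eigenvalue_unique; rewrite -{1}(sqr_mu_l0 g0) ltr_pM2r//.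
  by rewrite ltr_pXn2r ?nnegrE ?mu_l0_ge0// (le_trans (mu_l0_ge0 _) (ltW muE)).
Qed.
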